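(* Let $n\ge 1$. A permutation $\sigma\in\mathfrak{S}_n$ is a web permutation if and only if each cycle of $\sigma$ (fixed points being cycles of length 1) is an André cycle.
   Context: **Web permutations.** The cells of the $n\times n$ grid are indexed by $(i,j)$ with $1\le i,j\le n$ ($i$ is the $x$-coordinate, $j$ the $y$-coordinate). For $\sigma\in\mathfrak{S}_n$, a cell $(i,j)$ is a crossing of $\sigma$ if $\sigma(i)<j$ and $i<\sigma^{-1}(j)$; $\mathrm{Cr}(\sigma)$ is the set of crossings. A grid configuration is $G(\sigma,E)$, determined by a pair $(\sigma,E)$ with $\sigma\in\mathfrak{S}_n$ and $E\subseteq\mathrm{Cr}(\sigma)$; its remaining crossings are the elements of $\mathrm{Cr}(\sigma)\setminus E$. Order cells by $(x,y)\succeq(x',y')$ iff $x\le x'$ and $y\ge y'$. If $c=(i,j)$ is a $\succeq$-maximal remaining crossing of $G(\sigma,E)$, resolving $c$ produces two grid configurations: $G(\sigma,E\cup\{c\})$ (smoothing) and $G(\sigma',E)$ (switching), where $\sigma'(i)=j$, $\sigma'(\sigma^{-1}(j))=\sigma(i)$, and $\sigma'(k)=\sigma(k)$ for $k\ne i,\sigma^{-1}(j)$ (one has $E\subseteq\mathrm{Cr}(\sigma')$). Start from $G(\mathrm{id},\emptyset)$ and repeatedly replace each grid configuration having a remaining crossing by the two obtained by resolving a maximal one, until all are of the form $G(\sigma,\mathrm{Cr}(\sigma))$. The permutations $\sigma$ occurring are the web permutations of $[n]$ (the result does not depend on the choices of maximal crossings). **André permutations and cycles.** Here permutations are words of distinct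 positive integers. André permutations are defined recursively: the empty word and every one-letter word are André permutations; a word $w=w_1\cdots w_m$ with $m\ge 2$ and smallest letter $w_k$ is an André permutation if both $w_1\cdots w_{k-1}$ and $w_{k+1}\cdots w_m$ are André permutations and $\max\{w_1,\dots,w_{k-1}\}<\max\{w_{k+1},\dots,w_m\}$ (with $\max\emptyset=-\infty$). A cycle $C=(a_1,\dots,a_k)$ of distinct positive integers, written with $a_1=\min\{a_1,\dots,a_k\}$, is an André cycle if the word $a_2\cdots a_k$ is an André permutation. Cycle notation $(a_1,\dots,a_k)$ means $a_i\mapsto a_{i+1}$, $a_k\mapsto a_1$. *)

(* Defs.v *)
From mathcomp Require Import all_boot all_fingroup.

Set Implicit Arguments.
Unset Strict Implicit.
Unset Printing Implicit Defensive.

(* Both coordinates of a cell range over 'I_n, that is 0, ..., n-1 instead of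
   1, ..., n: crossings and the order on cells only use the order of indices. *)

Section GridConfigurations.
Variable n : nat.
Implicit Types (s : {perm 'I_n}) (c d : 'I_n * 'I_n) (E : {set 'I_n * 'I_n}).

Definition crossings s : {set 'I_n * 'I_n} :=
  [set c : 'I_n * 'I_n | (s c.1 < c.2) && (c.1 < (s^-1)%g c.2)].

Definition remaining s E := crossings s :\: E.

(* (x, y) is above (x', y') when it lies weakly to the north-west of it. *)
Definition cell_ge c d := (c.1 <= d.1) && (d.2 <= c.2).

Definition maximal_remaining s E c :=
  c \in remaining s E /\
  forall d, d \in remaining s E -> cell_ge d c -> d = c.

(* In a product of permutations the left factor is applied first, so this maps
   c.1 to c.2 and s^-1 c.2 to s c.1, and agrees with s elsewhere. *)
Definition switching s c : {perm 'I_n} :=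
  (tperm c.1 ((s^-1)%g c.2) * s)%g.

(* [resolution s E r]: some complete sequence of resolutions started from the
   grid configuration G(s, E) ends with the configurations G(t, crossings t),
   for t in the list r.  The maximal crossing resolved in each configuration is
   arbitrary. *)
Inductive resolution :
    {perm 'I_n} -> {set 'I_n * 'I_n} -> seq {perm 'I_n} -> Prop :=
| ResolutionDone s : resolution s (crossings s) [:: s]
| ResolutionStep s E c r1 r2 of
    maximal_remaining s E c &
    resolution s (c |: E) r1 &
    resolution (switching s c) E r2 :
  resolution s E (r1 ++ r2).

Definition web_permutation s :=
  exists2 r, resolution 1%g set0 r & s \in r.

End GridConfigurations.

Definition distinct_positive (w : seq nat) := uniq w && all (leq 1) w.

(* In [AndreSplit] the letters are positive, so the value 0 of the maximum of
   the empty word behaves as -oo: u and v are not both empty. *)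
Inductive andre_word : seq nat -> Prop :=
| AndreNil : andre_word [::]
| AndreOne x of 0 < x : andre_word [:: x]
| AndreSplit u a v of
    distinct_positive (u ++ a :: v) &
    2 <= size (u ++ a :: v) &
    all (leq a) (u ++ a :: v) &
    andre_word u &
    andre_word v &
    \max_(x <- u) x < \max_(x <- v) x :
  andre_word (u ++ a :: v).

(* (a_1, ..., a_k) is a cycle notation of the cycle of s with support C; the
   fixed points of s are the cycles with k = 1. *)
Definition cycle_notation n (s : {perm 'I_n}) (C : {set 'I_n})
    (c : seq 'I_n) :=
  [/\ uniq c, fcycle s c & c =i C].

(* The letter attached to i : 'I_n is the positive integer i + 1. *)
Definition letters n (c : seq 'I_n) : seq nat := [seq (val i).+1 | i <- c].

Definition andre_cycle n (s : {perm 'I_n}) (C : {set 'I_n}) :=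
  exists a w, [/\ cycle_notation s C (a :: w),
                  all (fun x : 'I_n => a <= x) w &
                  andre_word (letters w)].

(* Main.v *)
Require Import Defs.
From mathcomp Require Import all_boot all_fingroup.

Set Implicit Arguments.
Unset Strict Implicit.
Unset Printing Implicit Defensive.

(* Write each cycle as a word with its smallest letter first.  The Andre cycles
   are then the words obtained from one-letter words by concatenations X ++ Y
   in which the first letter of X is smaller than that of Y, and the last
   letter of X smaller than that of Y.

   Resolutions: a dot (x, s x) below a remaining crossing always joins the last
   letter x of a cycle word to its first letter s x.  If (i, j) is a maximal
   remaining crossing and k = s^-1 j, the cycle words X and Y through i and k
   thus go from s i to i and from j to k, and the crossing conditions s i < j
   and i < k are the ones that allow the concatenation X ++ Y, which is a cycle
   word after switching.

   Conversely, splitting the cycle words of t at their smallest non-initial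
   letter, again and again, gives a sequence of switchings from the identity to
   t in strictly decreasing rows.  Any such sequence can be followed in a
   resolution: smooth maximal crossings above the next cell of the sequence
   until that cell is maximal itself. *)

(** * Merge words and their relation to Andre words *)

Inductive merge_word : seq nat -> Prop :=
| MergeOne a : merge_word [:: a]
| MergeCat a u b v of
    merge_word (a :: u) & merge_word (b :: v) & a < b & last a u < last b v :
  merge_word ((a :: u) ++ b :: v).

(** Each concatenation keeps the smaller of the two first letters in front and the larger of the two
    last letters at the end, so these remain the minimum and the maximum. *)
Lemma merge_word_bounds w : merge_word w ->
  all (leq (head 0 w)) w && all (geq (last 0 w)) w.
Proof.
elim=> [a|a u b v _ /andP[hu lu] _ /andP[hv lv] ltab ltl].
  by rewrite /= !leqnn.
rewrite last_cat /= in hu lu hv lv *; rewrite !all_cat /=.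
case/andP: hu => _ hu; case/andP: hv => _ hv.
case/andP: lu => la lu; case/andP: lv => lb lv.
rewrite leqnn hu (ltnW ltab) lb lv !andbT /=.
rewrite (leq_trans la (ltnW ltl)) /=.
apply/andP; split.
  by apply: sub_all hv => x; apply: leq_trans; apply: ltnW.
by apply: sub_all lu => x /leq_trans; apply; apply: ltnW.
Qed.

Lemma merge_word_head a w : merge_word (a :: w) -> all (leq a) w.
Proof. by move/merge_word_bounds => /= /andP[/andP[]]. Qed.

Lemma merge_word_last a w x :
  merge_word (a :: w) -> x \in a :: w -> x <= last a w.
Proof. by move/merge_word_bounds => /andP[_ /allP h] /h. Qed.

(** The outermost concatenation need not occur at the least non-initial letter. If it does not, the
    left factor is split recursively and its right piece is reassociated with the right factor. *)
Lemma merge_word_split a w : w <> [::] -> uniq (a :: w) ->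
  merge_word (a :: w) ->
  exists u b v, [/\ w = u ++ b :: v,
    merge_word (a :: u), merge_word (b :: v),
    (a < b) && (last a u < last b v) & all (ltn b) u].
Proof.
move=> w0 uw mw; move Ez: (a :: w) mw uw => z mz.
elim: mz a w w0 Ez => {z} [a|a u b v mu IHu mv _ ab luv] a' w w0 [-> ew];
  subst w => //.
rewrite cat_uniq => /and3P[uu dis uv].
case: (boolP (all (ltn b) u)) => [bu|nbu].
  by exists u, b, v; split; rewrite ?ab ?luv.
have u0 : u <> [::] by move=> u0; rewrite u0 in nbu.
have [u1 [c [u2 [eu m1 m2 /andP[ac l12] cu]]]] := IHu _ _ u0 erefl uu.
(* Some letter of [u] is at most [b], and [c] is the least letter of [u]. Equality is excluded
   because [b] does not occur in the left factor. *)
have cb : c < b.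
  case/allPn: nbu => x; rewrite eu mem_cat => xu; rewrite /= -leqNgt => xb.
  have {xu}cx : c <= x.
    case/orP: xu => [/(allP cu)/ltnW //|].
    by rewrite inE => /predU1P[-> //|]; apply: (allP (merge_word_head m2)).
  rewrite ltn_neqAle (leq_trans cx xb) andbT; apply/eqP => ecb.
  case/hasP: dis; exists c; first by rewrite ecb mem_head.
  by rewrite /= inE eu mem_cat mem_head !orbT.
exists u1, c, (u2 ++ b :: v); split=> //.
- by rewrite eu -catA.
- apply: MergeCat => //.
  by move: luv; rewrite eu last_cat.
- rewrite ac last_cat /=; apply: (ltn_trans l12).
  by move: luv; rewrite eu last_cat.
Qed.

(** With [a] in front, the split at the least letter [b] becomes the concatenation of [a :: u] and
    [b :: v]. Merge words end in their maximum, so comparing maxima amounts to comparing last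
    letters. The letter in front is arbitrary because the induction uses [a] for [u] and [b] for
    [v]. *)
Lemma andre_merge_word w : andre_word w ->
  forall a, all (ltn a) w -> merge_word (a :: w).
Proof.
elim=> {w} [a _|x _ a /= /andP[ax _]|u b v duv _ bw _ IHu _ IHv muv a aw].
- exact: MergeOne.
- exact: (@MergeCat a [::] x [::] (MergeOne _) (MergeOne _)).
move: aw; rewrite all_cat /= => /and3P[au ab av].
have bv : all (ltn b) v.
  move: bw; rewrite all_cat /= => /and3P[_ _ /allP bv].
  move: duv => /andP[]; rewrite cat_uniq /= => /and3P[_ _ /andP[nbv _]] _.
  apply/allP => x xv; rewrite /= ltn_neqAle bv // andbT.
  by apply: contraNneq nbv => ->.
have mv := IHv b bv.
apply: (MergeCat (IHu a au) mv ab).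
apply: (@leq_trans (\max_(x <- v) x)); last first.
  apply/bigmax_leqP_seq => x xv _; apply: merge_word_last mv _.
  by rewrite inE xv orbT.
case: (u) muv => [|c u'] muv /=; last first.
  apply: leq_ltn_trans muv.
  by apply: leq_bigmax_seq => //; rewrite mem_last.
(* Here [u] is empty, so the left factor ends in [a]. The empty maximum is 0, which forces [v] to be
   nonempty, and its letters exceed [b], hence [a]. *)
case: v bv muv {av IHv mv duv bw} => [|d v] /=; first by rewrite !big_nil.
case/andP => bd _ _; apply: (ltn_trans ab); apply: (leq_trans bd).
by apply: leq_bigmax_seq => //; rewrite mem_head.
Qed.

(** The induction is on length because the split at the least letter of [w] need not be the
    outermost concatenation of the given derivation. *)
Lemma merge_word_andre a w : uniq (a :: w) -> all (leq 1) w ->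
  merge_word (a :: w) -> andre_word w.
Proof.
have [k] := ubnP (size w); elim: k a w => // k IHk a w sz uw pw mw.
have [w0|w0] := eqVneq w [::]; first by rewrite w0; apply: AndreNil.
have [u [b [v [ew mu mv /andP[ab luv] bu]]]] :=
  merge_word_split (elimN eqP w0) uw mw.
have dw : distinct_positive w.
  by rewrite /distinct_positive pw andbT; case/andP: uw.
rewrite ew in sz uw pw dw *.
have [us vs] : size u < k /\ size v < k.
  move: sz; rewrite size_cat /= addnS ltnS.
  by split; apply: leq_ltn_trans sz; rewrite ?leq_addr ?leq_addl.
move: pw; rewrite all_cat /= => /and3P[pu pb pv].
move: (uw); rewrite -[a :: _]/((a :: u) ++ b :: v) cat_uniq => /and3P[uu _ uv].
have au := IHk _ _ us uu pu mu.
have av := IHk _ _ vs uv pv mv.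
case: (posnP (size (u ++ v))) => [/eqP|s0].
  rewrite size_cat addn_eq0 !size_eq0 => /andP[/eqP -> /eqP ->].
  exact: AndreOne.
apply: AndreSplit => //.
- by rewrite size_cat /= addnS ltnS -size_cat.
- rewrite all_cat /= leqnn (merge_word_head mv) !andbT.
  by apply: sub_all bu => x /ltnW.
(* If [v] were empty, [u] would not be, and its last letter would be both above and below [b]. *)
case: v mv luv {av vs uv sz ew uw dw} pv s0 => [|d v] mv luv pv s0.
  rewrite cats0 in s0; case: u bu s0 luv {us mu uu pu au} => // c u /allP bu _.
  by move/(ltn_trans (bu _ (mem_last c u))); rewrite ltnn.
apply: (@leq_trans (last d v)); last first.
  by apply: leq_bigmax_seq => //; rewrite mem_last.
(* For empty [u] the maximum is 0, and positivity of the letters of [v] concludes. *)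
case: u mu {us bu uu pu au s0} luv => [|c u] mu luv.
  by rewrite big_nil; apply: (allP pv); rewrite mem_last.
apply: leq_ltn_trans luv.
apply/bigmax_leqP_seq => x xu _; apply: merge_word_last mu _.
by rewrite inE xu orbT.
Qed.

(** * Cycle words and products with transpositions *)

Lemma eq_in_fpath (T : eqType) (f g : T -> T) a p :
  {in belast a p, f =1 g} -> fpath f a p = fpath g a p.
Proof.
elim: p a => //= b p IHp a fg; rewrite fg ?mem_head //; congr (_ && _).
by apply: IHp => x xp; apply: fg; rewrite inE xp orbT.
Qed.

Section CycleWords.
Variable n : nat.
Implicit Types (s t : {perm 'I_n}) (w u v : seq 'I_n) (x y a b : 'I_n).

Lemma eq_in_fpath_tperm s x y a w :
  x \notin belast a w -> y \notin belast a w ->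
  fpath (tperm x y * s)%g a w = fpath s a w.
Proof.
move=> xw yw; apply: eq_in_fpath => z zw; rewrite permM tpermD //.
  by apply: contraNneq xw => ->.
by apply: contraNneq yw => ->.
Qed.

Lemma fcycle_tperm_notin s x y w : x \notin w -> y \notin w ->
  fcycle (tperm x y * s)%g w = fcycle s w.
Proof.
by case: w => //= a w xw yw; apply: eq_in_fpath_tperm; rewrite belast_rcons.
Qed.

(** The transposition only moves the two last letters, so arrows inside the words are unchanged. The
    two closing arrows exchange their targets, which opens both cycles and links them into one. *)
Lemma fcycle_tperm_cat s a u b v : uniq ((a :: u) ++ b :: v) ->
  let s' := (tperm (last a u) (last b v) * s)%g in
  fcycle s' ((a :: u) ++ b :: v) = fcycle s (a :: u) && fcycle s (b :: v).
Proof.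
move=> uw s'; move: uw; rewrite cat_uniq => /and3P[uu dis uv].
have hu z : z \in a :: u -> z \notin b :: v.
  by move=> zu; apply: contra dis => zv; apply/hasP; exists z.
have hv z : z \in b :: v -> z \notin a :: u.
  by move=> zv; apply: contra dis => zu; apply/hasP; exists z.
have bu : last a u \notin belast a u.
  by move: uu; rewrite lastI rcons_uniq => /andP[].
have bv : last b v \notin belast b v.
  by move: uv; rewrite lastI rcons_uniq => /andP[].
have e1 : fpath s' a u = fpath s a u.
  apply: eq_in_fpath_tperm => //; apply: contra (hv _ (mem_last b v)).
  exact: mem_belast.
have e2 : fpath s' b v = fpath s b v.
  apply: eq_in_fpath_tperm => //; apply: contra (hu _ (mem_last a u)).
  exact: mem_belast.
rewrite /= !rcons_path cat_path last_cat /= e1 e2 /s' !permM tpermL tpermR.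
by rewrite -!andbA; do !bool_congr; rewrite andbC -andbA andbCA.
Qed.

Definition cycle_word s w :=
  [/\ merge_word (letters w), uniq w & fcycle s w].

Lemma letters_uniq w : uniq (letters w) = uniq w.
Proof. by apply: map_inj_uniq => x y [] /val_inj. Qed.

Lemma letters_last a w : last (val a).+1 (letters w) = (val (last a w)).+1.
Proof. by rewrite (last_map (fun i : 'I_n => (val i).+1)). Qed.

Lemma letters_mem w x : ((val x).+1 \in letters w) = (x \in w).
Proof. by apply: mem_map => y z [] /val_inj. Qed.

Lemma cycle_word_cons s w : cycle_word s w -> exists a u, w = a :: u.
Proof. by case: w => [[m]|a u]; [inversion m | exists a, u]. Qed.

Lemma cycle_word_head s a w x : cycle_word s (a :: w) -> x \in a :: w ->
  a <= x.
Proof.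
case=> mw _ _; rewrite inE => /predU1P[-> //| xw].
by rewrite -ltnS; apply: (allP (merge_word_head mw)); rewrite letters_mem.
Qed.

Lemma cycle_word_perm_last s a w : cycle_word s (a :: w) -> s (last a w) = a.
Proof. by case=> _ _; rewrite /= rcons_path => /andP[_ /eqP]. Qed.

(** Both words list the orbit of [x], and both start at its least element. *)
Lemma cycle_word_unique s w1 w2 x : cycle_word s w1 -> cycle_word s w2 ->
  x \in w1 -> x \in w2 -> w1 = w2.
Proof.
move=> c1 c2; have [a [u e1]] := cycle_word_cons c1.
have [b [v e2]] := cycle_word_cons c2; subst w1 w2 => x1 x2.
have [_ u1 f1] := c1; have [_ u2 f2] := c2.
have e12 : a :: u =i b :: v.
  by move=> y; rewrite -(fconnect_cycle f1 x1) -(fconnect_cycle f2 x2).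
have eab : a = b.
  apply/val_inj/eqP; rewrite eqn_leq (cycle_word_head c1) ?e12 ?mem_head //.
  by rewrite (cycle_word_head c2) // -e12 mem_head.
move: eab e12 u2 f2 => <- _ u2 f2.
have := fingraph.orbitE f1 u1 (mem_head _ _).
rewrite (fingraph.orbitE f2 u2 (mem_head _ _)).
by rewrite /= eqxx !rot0.
Qed.

Lemma cycle_word_merge s a u b v :
  cycle_word s (a :: u) -> cycle_word s (b :: v) ->
  ~~ has (mem (a :: u)) (b :: v) -> a < b -> last a u < last b v ->
  cycle_word (tperm (last a u) (last b v) * s)%g ((a :: u) ++ b :: v).
Proof.
move=> [mu uu fu] [mv uv fv] dis ab luv.
have uw : uniq ((a :: u) ++ b :: v) by rewrite cat_uniq uu dis.
split=> //; last by rewrite fcycle_tperm_cat // fu.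
by rewrite /letters map_cat; apply: MergeCat; rewrite ?letters_last.
Qed.

Lemma letters_cat_inv w (p q : seq nat) (m : nat) : letters w = p ++ m :: q ->
  exists u' b' v', [/\ w = u' ++ b' :: v', p = letters u', m = (val b').+1
    & q = letters v'].
Proof.
move=> ew; have := cat_take_drop (size p) w; move: (congr1 (drop (size p)) ew).
rewrite drop_size_cat // -map_drop.
case: (drop _ _) => [//|b' v'] [<- <-] <-; exists (take (size p) w), b', v'.
split=> //; have := congr1 (take (size p)) ew.
by rewrite take_size_cat // -map_take.
Qed.

(** This inverts [cycle_word_merge]: multiplying by the same transposition again separates the two
    factors. The last conjunct makes [b] the least non-initial letter. *)
Lemma cycle_word_split s a w : w <> [::] -> cycle_word s (a :: w) ->
  exists u b v, let s' := (tperm (last a u) (last b v) * s)%g in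
  [/\ w = u ++ b :: v, cycle_word s' (a :: u), cycle_word s' (b :: v),
    (a < b) && (last a u < last b v) & {in u, forall x, b < x}].
Proof.
move=> w0 [mw uw fw]; have w0' : letters w <> [::] by case: (w) w0.
have uw' : uniq ((val a).+1 :: letters w).
  by rewrite -[_ :: _]/(letters (a :: w)) letters_uniq.
have [u0 [b0 [v0 [e]]]] := merge_word_split w0' uw' mw.
have [u [b [v [ew -> -> ->]]]] := letters_cat_inv e => mu mv.
rewrite !letters_last !ltnS => abl /allP bu.
exists u, b, v => s'; move: uw fw; rewrite ew -cat_cons => uw fw.
have es : s = (tperm (last a u) (last b v) * s')%g.
  by rewrite mulgA tperm2 mul1g.
rewrite es fcycle_tperm_cat // in fw; case/andP: fw => fu fv.
move: uw; rewrite cat_uniq => /and3P[uu _ uv].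
by split=> // x xu; have := bu (val x).+1; rewrite letters_mem xu => /(_ isT).
Qed.

End CycleWords.

(** * Resolutions and the region they act on *)

Section Resolutions.
Variable n : nat.
Implicit Types (s t : {perm 'I_n}) (c d e : 'I_n * 'I_n).
Implicit Types (E : {set 'I_n * 'I_n}) (cs : seq ('I_n * 'I_n)).

Lemma cell_ge_refl c : cell_ge c c.
Proof. by rewrite /cell_ge !leqnn. Qed.

Lemma cell_ge_trans d c e : cell_ge c d -> cell_ge d e -> cell_ge c e.
Proof.
case/andP=> cd1 cd2 /andP[de1 de2].
by rewrite /cell_ge (leq_trans cd1 de1) (leq_trans de2 cd2).
Qed.

(** Write [c = (i, j)], [k = s^-1 j] and [d = (x, y)]. If [x < i], the image of [x] is unchanged and
    the preimage of [y] can only move between [i] and [k], both beyond [x]. If [j < y], the preimage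
    of [y] is unchanged and the image of [x] can only move between [s i] and [j], both less than
    [y]. *)
Lemma switching_crossings s c d : c \in crossings s -> ~~ cell_ge c d ->
  (d \in crossings (switching s c)) = (d \in crossings s).
Proof.
rewrite !inE /cell_ge /switching invMg tpermV !permM negb_and -!ltnNge.
case: c d => [i j] [x y] /=; set k := (s^-1)%g j => /andP[sij ik] xy.
have sk : s k = j by rewrite permKV.
case/orP: xy => [xi|jy].
  have xk := ltn_trans xi ik.
  rewrite (@tpermD _ i k x) -?val_eqE ?gtn_eqF //.
  by case: tpermP => [->|->|//]; rewrite xi xk.
rewrite (@tpermD _ i k (s^-1 y)%g).
- by case: tpermP => [->|->|//]; rewrite sk jy (ltn_trans sij jy).
- apply: contraTneq sij => ->; rewrite permKV -leqNgt; exact: ltnW.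
- by apply: contraTneq jy => /perm_inj ->; rewrite ltnn.
Qed.

Lemma switching_notin_crossings s c : c \notin crossings (switching s c).
Proof. by rewrite inE permM tpermL permKV ltnn. Qed.

Lemma remaining_smooth s E c d : maximal_remaining s E c ->
  d \in remaining s (c |: E) -> d \in remaining s E /\ ~~ cell_ge d c.
Proof.
case=> _ maxc; rewrite !inE negb_or -andbA => /and3P[dc dE dX].
have dr : d \in remaining s E by rewrite !inE dE.
by rewrite dE dX; split=> //; apply: contra dc => /(maxc _ dr) ->.
Qed.

(** New crossings can only arise below [c]. Any other remaining crossing is old, and by maximality
    of [c] it is not above [c]. *)
Lemma remaining_switching s E c d : maximal_remaining s E c ->
  d \in remaining (switching s c) E ->
  (exists2 d', d' \in remaining s E & cell_ge d' d) /\ ~~ cell_ge d c.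
Proof.
case=> cr maxc /setDP[dX dE]; have /setDP[cX _] := cr.
have dc : d != c.
  by apply: contraTneq dX => ->; apply: switching_notin_crossings.
have [cd|ncd] := boolP (cell_ge c d).
  split; first by exists c.
  apply: contra dc; case: c d cd {cr maxc dX dE cX} => [i j] [x y].
  rewrite /cell_ge /= => /andP[ix yj] /andP[xi jy].
  by rewrite xpair_eqE -!val_eqE !eqn_leq ix yj xi jy.
have dr : d \in remaining s E.
  by apply/setDP; rewrite -(switching_crossings cX ncd).
split; first by exists d => //; apply: cell_ge_refl.
by apply: contra dc => /(maxc _ dr) ->.
Qed.

Lemma maximal_remaining_above s E a : a \in remaining s E ->
  exists2 c, maximal_remaining s E c & cell_ge c a.
Proof.
move=> ar; pose P := [pred d | (d \in remaining s E) && cell_ge d a].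
have Pa : P a by rewrite /= ar cell_ge_refl.
(* The quantity [(n - x) + y] strictly increases towards the north-west, so a cell maximizing it is
   maximal for the order. *)
case: (arg_maxnP (fun d => (n - d.1) + d.2) Pa) => c /andP[cr ca] maxc.
exists c => //; split=> // d dr dc.
have := maxc d; rewrite /= dr (cell_ge_trans dc ca) => /(_ isT).
case: c d dc {cr ca maxc dr} => [i j] [x y].
rewrite /cell_ge /= => /andP[xi jy].
have ni := ltn_ord i; have nx := ltn_ord x.
move=> h; have h1 : n - i <= n - x by rewrite leq_sub2l.
have /eqP exi : n - i == n - x.
  rewrite eqn_leq h1 /= -(leq_add2r y).
  by rewrite (leq_trans h) // leq_add2l.
have eyj : y <= j by move: h; rewrite exi leq_add2l.
congr pair; apply/val_inj/eqP; rewrite eqn_leq ?jy ?xi ?andbT //=.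
by rewrite -(subKn (ltnW ni)) exi subKn // ltnW.
Qed.

(** The region that later resolutions can affect. Each resolution shrinks it and removes the
    resolved cell, so its cardinality serves as induction measure. *)
Definition below s E : {set 'I_n * 'I_n} :=
  [set z | [exists d in remaining s E, cell_ge d z]].

Lemma below_remaining s E d : d \in remaining s E -> d \in below s E.
Proof.
by move=> dr; rewrite inE; apply/existsP; exists d; rewrite dr cell_ge_refl.
Qed.

Lemma below_ge s E c d : c \in below s E -> cell_ge c d -> d \in below s E.
Proof.
rewrite !inE => /existsP[e /andP[er ec]] cd; apply/existsP; exists e.
by rewrite er (cell_ge_trans ec cd).
Qed.

Lemma below_smooth s E c : maximal_remaining s E c ->
  below s (c |: E) \subset below s E :\ c.
Proof.
move=> mc; apply/subsetP => z; rewrite inE => /existsP[d /andP[dr dz]].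
have [dr' dc] := remaining_smooth mc dr.
rewrite !inE; apply/andP; split; first by apply: contraNneq dc => <-.
by apply/existsP; exists d; rewrite dr'.
Qed.

Lemma below_switching s E c : maximal_remaining s E c ->
  below (switching s c) E \subset below s E :\ c.
Proof.
move=> mc; apply/subsetP => z; rewrite inE => /existsP[d /andP[dr dz]].
have [[d' dr' dd'] dc] := remaining_switching mc dr.
rewrite !inE; apply/andP; split; first by apply: contraNneq dc => <-.
by apply/existsP; exists d'; rewrite dr' (cell_ge_trans dd').
Qed.

(** Smoothed cells stay outside the active region, so no later switching destroys them as crossings.
    Once no crossing remains, [E] is therefore exactly [crossings s]. *)
Definition coherent s E := E \subset crossings s :\: below s E.

Lemma coherent_smooth s E c : maximal_remaining s E c -> coherent s E ->
  coherent s (c |: E).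
Proof.
move=> mc /subsetP coh; have /subsetP sb := below_smooth mc.
have [/setDP[cX _] _] := mc.
apply/subsetP => e; rewrite 2!inE => eE; rewrite inE.
have eX : e \in crossings s by case/orP: eE => [/eqP -> //|/coh/setDP[]].
rewrite eX andbT; apply/negP => /sb; rewrite 2!inE => /andP[ec eb].
by case/orP: eE => [|/coh]; [apply/negP | rewrite inE eb].
Qed.

Lemma coherent_switching s E c : maximal_remaining s E c -> coherent s E ->
  coherent (switching s c) E.
Proof.
move=> mc /subsetP coh; have /subsetP sb := below_switching mc.
have [cr _] := mc; have /setDP[cX _] := cr.
apply/subsetP => e eE; have /setDP[eX eb] := coh e eE.
rewrite inE switching_crossings ?eX //; last first.
  by apply: contra eb => /(below_ge (below_remaining cr)).
by rewrite andbT; apply: contra eb => /sb/setD1P[].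
Qed.

Fixpoint switchable s cs :=
  if cs is c :: cs' then (c \in crossings s) && switchable (switching s c) cs'
  else true.

Lemma switchable_rcons s cs c : switchable s (rcons cs c) =
  switchable s cs && (c \in crossings (foldl (@switching n) s cs)).
Proof. by elim: cs s => [|d cs IH] s /=; rewrite ?andbT // IH andbA. Qed.

(** The last hypothesis keeps all smoothed cells in rows at or above that of the next cell. As rows
    strictly decrease along [cs], no later cell has been smoothed. *)
Lemma resolution_foldl_switching s E cs : coherent s E -> switchable s cs ->
  sorted (fun c d => d.2 < c.2) cs ->
  (forall c, ohead cs = Some c -> c \notin E /\ {in E, forall e, c.2 <= e.2}) ->
  exists2 r, resolution s E r & foldl (@switching n) s cs \in r.
Proof.
have [m] := ubnP #|below s E|; elim: m => // m IHm in s E cs *.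
move=> lem coh sw so hd.
have [r0|[a ar]] := set_0Vmem (remaining s E).
  have EX : E = crossings s.
    apply/eqP; rewrite eqEsubset -[crossings s \subset E]setD_eq0.
    rewrite -/(remaining s E) r0 eqxx.
    by rewrite andbT; apply: subset_trans coh (subsetDl _ _).
  (* A next cell would still be a remaining crossing, so the sequence is exhausted. *)
  case: cs sw so hd => [|c cs] /=; last first.
    by case/andP=> cX _ _ /(_ c erefl)[]; rewrite EX cX.
  by exists [:: s]; rewrite ?mem_head // EX; apply: ResolutionDone.
have small (b : {set 'I_n * 'I_n}) c :
    maximal_remaining s E c -> b \subset below s E :\ c -> #|b| < m.
  move=> [cr _] lb; apply: leq_ltn_trans (subset_leq_card lb) _.
  by move: lem; rewrite ltnS (cardsD1 c) below_remaining.
have smooth c cs' (mc : maximal_remaining s E c) :=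
  IHm s (c |: E) cs' (small _ _ mc (below_smooth mc)) (coherent_smooth mc coh).
have switch c cs' (mc : maximal_remaining s E c) :=
  IHm _ E cs' (small _ _ mc (below_switching mc)) (coherent_switching mc coh).
have [c mc cP] : exists2 c, maximal_remaining s E c &
    if cs is c0 :: _ then cell_ge c c0 else true.
  case: cs sw so hd => [|c0 cs] sw so hd.
    by have [c mc _] := maximal_remaining_above ar; exists c.
  apply: maximal_remaining_above; have [c0E _] := hd c0 erefl.
  by rewrite inE c0E; case/andP: sw.
(* The branch that is not followed only needs some complete resolution, obtained from the empty
   sequence. *)
have [r1' R1' _] := smooth c [::] mc isT isT ltac:(by []).
have [r2' R2' _] := switch c [::] mc isT isT ltac:(by []).
have [ecc|ncc] := eqVneq (ohead cs) (Some c); last first.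
  (* Smooth [c]: if there is a next cell, [c] is above it, so the row bound on smoothed cells
     persists. *)
  have [|r1 R1 s1] := smooth c cs mc sw so.
    case: cs ncc cP {sw so smooth switch} hd => //= c0 cs ncc cc0 hd _ [<-].
    have [c0E hE] := hd c0 erefl.
    rewrite !inE negb_or c0E andbT; split=> // e.
    by rewrite !inE => /predU1P[->|/hE //]; case/andP: cc0.
  exists (r1 ++ r2'); first exact: ResolutionStep mc R1 R2'.
  by rewrite mem_cat s1.
case: cs ecc sw so hd {cP} => // c0 cs [ecc]; subst c0 => /andP[_ sw] so hd.
have [_ hE] := hd c erefl.
(* Switch at [c]: the following cell is in a strictly lower row than every smoothed cell, hence not
   in [E]. *)
have [|r2 R2 s2] := switch c cs mc sw (path_sorted so).
  move=> c1; case: cs so {hd sw} => //= c2 cs /andP[lt _] [<-].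
  split=> [|e /hE /(leq_trans (ltnW lt)) //].
  by apply: contraL lt => /hE; rewrite -leqNgt.
exists (r1' ++ r2); first exact: ResolutionStep mc R1' R2.
by rewrite mem_cat s2 orbT.
Qed.

End Resolutions.

(** * Cycle words along resolutions, and Andre cycles *)

Section AndreCycles.
Variable n : nat.
Implicit Types (s t : {perm 'I_n}) (c d e : 'I_n * 'I_n) (x y : 'I_n).
Implicit Types (E : {set 'I_n * 'I_n}) (cs : seq ('I_n * 'I_n)).
Implicit Types (w u v : seq 'I_n).

(** By [andre_cycle_porbit] this says that all cycles are Andre cycles, in a form suited to
    following switchings. *)
Definition merge_perm s := forall x, exists2 w, cycle_word s w & x \in w.

(* Only the dots of s in [below s E] can be moved by further resolutions. *)
Definition open_last s E := forall x w, cycle_word s w -> x \in w ->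
  (x, s x) \in below s E -> last x w = x.

Lemma cycle_word_tperm s a u b v w :
  cycle_word s (a :: u) -> cycle_word s (b :: v) -> cycle_word s w ->
  w != a :: u -> w != b :: v ->
  cycle_word (tperm (last a u) (last b v) * s)%g w.
Proof.
move=> cu cv cw wu wv; have [mw uw fw] := cw; split=> //.
rewrite fcycle_tperm_notin //.
  by apply: contra wu => h; rewrite (cycle_word_unique cw cu h) // mem_last.
by apply: contra wv => h; rewrite (cycle_word_unique cw cv h) // mem_last.
Qed.

Lemma cycle_word_disjoint s w1 w2 : cycle_word s w1 -> cycle_word s w2 ->
  w1 != w2 -> ~~ has (mem w1) w2.
Proof.
move=> c1 c2; apply: contra => /hasP[x x2 x1].
by rewrite (cycle_word_unique c1 c2 x1 x2).
Qed.

Lemma merge_perm_switching s E c : maximal_remaining s E c ->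
  merge_perm s -> open_last s E ->
  merge_perm (switching s c) /\ open_last (switching s c) E.
Proof.
move=> mc ms os; have [cr _] := mc; have /setDP[cX _] := cr.
move: (cX); rewrite inE => /andP[].
set k := (s^-1)%g c.2 => sij ik; have sk : s k = c.2 by rewrite permKV.
have cb := below_remaining cr.
have [X cwX iX] := ms c.1; have [Y cwY kY] := ms k.
(* The dots [(c.1, s c.1)] and [(k, c.2)] both lie below [c], so [c.1] and [k] end their words. *)
have lX : last c.1 X = c.1.
  by apply: os cwX iX _; apply: below_ge cb _; rewrite /cell_ge leqnn ltnW.
have lY : last k Y = k.
  by apply: os cwY kY _; apply: below_ge cb _; rewrite /cell_ge sk leqnn ltnW.
have XY : X != Y.
  apply: contraTneq ik => eXY; rewrite -leqNgt.
  have [a [u eX]] := cycle_word_cons cwX.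
  by rewrite -lY -eXY -lX eX.
have [a [u eX]] := cycle_word_cons cwX.
have [b [v eY]] := cycle_word_cons cwY.
rewrite eX /= in lX; rewrite eY /= in lY.
have dis := cycle_word_disjoint cwX cwY XY.
have old w : cycle_word s w -> w != X -> w != Y -> cycle_word (switching s c) w.
  move=> cw wX wY; rewrite /switching -/k -lX -lY.
  by subst X Y; apply: cycle_word_tperm.
have cwXY : cycle_word (switching s c) (X ++ Y).
  rewrite /switching -/k -lX -lY; subst X Y.
  apply: cycle_word_merge => //; last by rewrite lX lY.
  by rewrite -(cycle_word_perm_last cwX) -(cycle_word_perm_last cwY) lX lY sk.
have keep x w : x \notin X ++ Y -> cycle_word s w -> x \in w ->
    cycle_word (switching s c) w.
  rewrite mem_cat negb_or => /andP[xX xY] cw xw; apply: old => //.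
    by apply: contraNneq xX => <-.
  by apply: contraNneq xY => <-.
split=> [x|x w cw xw xb].
  have [xXY|nXY] := boolP (x \in X ++ Y); first by exists (X ++ Y).
  by have [w cw xw] := ms x; exists w => //; apply: keep cw xw.
have /setD1P[xc xb'] := subsetP (below_switching mc) _ xb.
have [xXY|nXY] := boolP (x \in X ++ Y); last first.
  have [w' cw' xw'] := ms x.
  rewrite (cycle_word_unique cw (keep _ _ nXY cw' xw') xw xw').
  apply: os => //; rewrite /switching permM tpermD // in xb'.
    by apply: contraNneq nXY => <-; rewrite mem_cat iX.
  by apply: contraNneq nXY => <-; rewrite mem_cat kY orbT.
(* The merged word ends in [k]. The new dot of [c.1] is [c] itself, which has left the region. Any
   other letter keeps its dot, so if that dot is still in the region, the letter ends [X] or [Y] and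
   is [c.1] or [k]. *)
rewrite (cycle_word_unique cw cwXY xw xXY) last_cat eY /= lY.
apply/eqP; rewrite eq_sym; apply: contraTT xXY => xk.
have xi : x != c.1.
  apply: contraNneq xc => ->; rewrite /switching permM tpermL permKV.
  by case: (c).
rewrite /switching permM tpermD 1?eq_sym // in xb'.
rewrite mem_cat negb_or; apply/andP; split.
  by apply: contra xi => xX; rewrite -(os _ _ cwX xX xb') eX /= lX.
by apply: contra xk => xY; rewrite -(os _ _ cwY xY xb') eY /= lY.
Qed.

Lemma open_last_smooth s E c : maximal_remaining s E c ->
  open_last s E -> open_last s (c |: E).
Proof.
move=> mc os x w cw xw /(subsetP (below_smooth mc))/setD1P[_].
exact: os.
Qed.

Lemma resolution_merge_perm s E r : resolution s E r ->
  merge_perm s -> open_last s E -> forall t, t \in r -> merge_perm t.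
Proof.
elim=> {s E r} [s ms _ t|s E c r1 r2 mc _ IH1 _ IH2 ms os t].
  by rewrite inE => /eqP->.
rewrite mem_cat => /orP[]; first exact/IH1/open_last_smooth.
by have [ms' os'] := merge_perm_switching mc ms os; apply: IH2.
Qed.

Lemma cycle_word1 x : cycle_word (1%g : {perm 'I_n}) [:: x].
Proof. by split=> //; [exact: MergeOne | rewrite /= perm1 eqxx]. Qed.

Lemma merge_perm1 : merge_perm 1%g.
Proof. by move=> x; exists [:: x]; [exact: cycle_word1 | exact: mem_head]. Qed.

Lemma open_last1 : open_last 1%g set0.
Proof.
move=> x w cw xw _.
by rewrite (cycle_word_unique cw (cycle_word1 x) xw) ?mem_head.
Qed.

Lemma web_permutation_merge_perm s : web_permutation s -> merge_perm s.
Proof.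
case=> r /resolution_merge_perm; apply; first exact: merge_perm1.
exact: open_last1.
Qed.

(* Induction on [m] from [n] down to [0].  If [m] does not start its cycle word,
   it is the first letter of the right factor in the splitting of that word. *)
Lemma merge_perm_switchings t m : merge_perm t ->
  (forall w x, cycle_word t w -> x \in w -> x < m -> head x w = x) ->
  exists cs, [/\ switchable 1%g cs, foldl (@switching n) 1%g cs = t,
    sorted (fun c d => d.2 < c.2) cs & all (fun c => m <= c.2) cs].
Proof.
have [k] := ubnP (n - m); elim: k => // k IHk in m t *.
rewrite ltnS => lek mt hd; have [mn|nm] := leqP n m.
  (* Every letter starts its cycle word, so all words have one letter and [t] is the identity. *)
  exists [::]; split=> //=; apply/permP => x; rewrite perm1.
  have [w cw xw] := mt x.
  have hall y : y \in w -> head y w = y.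
    by move=> yw; apply: hd => //; apply: leq_trans mn.
  have [a [u ew]] := cycle_word_cons cw; subst w.
  have := cycle_word_perm_last cw; have /= <- := hall _ (mem_last a u).
  by have /= <- := hall _ xw.
pose y := Ordinal nm; have lek' : n - m.+1 < k.
  by apply: leq_trans lek; rewrite ltn_sub2l.
have [w cw yw] := mt y; have [a [z ew]] := cycle_word_cons cw; subst w.
have [eay|nay] := eqVneq a y.
  have [|cs [sw fs ss al]] := IHk m.+1 t lek' mt.
    move=> w x cw' xw; rewrite ltnS leq_eqVlt => /predU1P[exm|]; last exact: hd.
    have exy : x = y by apply: val_inj.
    by rewrite exy in xw *; rewrite (cycle_word_unique cw' cw xw yw).
  by exists cs; split=> //; apply: sub_all al => c /ltnW.
have z0 : z <> [::].
  by move=> z0; move: yw nay; rewrite z0 inE => /eqP ->; rewrite eqxx.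
have [u [b [v [ez cu cv /andP[ab luv] bu]]]] := cycle_word_split z0 cw.
set s' := (_ * t)%g in cu cv.
have et : t = (tperm (last a u) (last b v) * s')%g.
  by rewrite mulgA tperm2 mul1g.
have [_ uw _] := cw.
have nhd x : x \in z -> m <= x.
  move=> xz; rewrite leqNgt; apply/negP => xm.
  have xw : x \in a :: z by rewrite inE xz orbT.
  have /= ax := hd _ _ cw xw xm.
  by move: uw; rewrite /= ax xz.
(* Letters below [m] start their words, so none occurs in [z], whereas [m] does; and [b] is the
   least letter of [z]. *)
have bm : b = m :> nat.
  apply/eqP; rewrite eqn_leq nhd ?ez ?mem_cat ?mem_head ?orbT // andbT.
  move: yw; rewrite inE eq_sym (negPf nay) /= ez mem_cat => /orP[yu|yv].
    exact/ltnW/(bu y yu).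
  exact: (cycle_word_head cv yv).
have ezw : a :: z = (a :: u) ++ b :: v by rewrite ez.
have keep x w : x \notin a :: z -> cycle_word t w -> x \in w -> cycle_word s' w.
  move=> xz cw' xw.
  have nw x' : x' \in a :: z -> x' \notin w.
    move=> x'z; apply: contra xz => x'w.
    by rewrite (cycle_word_unique cw cw' x'z x'w).
  case: cw' => mw' uw' fw'; split=> //; rewrite fcycle_tperm_notin //; apply: nw.
    by rewrite ezw mem_cat mem_last.
  by rewrite ezw mem_cat mem_last orbT.
have ms' : merge_perm s'.
  move=> x; have [|xz] := boolP (x \in a :: z).
    by rewrite ezw mem_cat => /orP[xu|xv]; [exists (a :: u) | exists (b :: v)].
  by have [w cw' xw] := mt x; exists w => //; apply: keep cw' xw.
have hd' w x : cycle_word s' w -> x \in w -> x < m.+1 -> head x w = x.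
  move=> cw' xw; rewrite ltnS => xm; have [|xz] := boolP (x \in a :: z).
    rewrite ezw mem_cat => /orP[xu|xv].
      rewrite (cycle_word_unique cw' cu xw xu) /=.
      move: xu; rewrite inE => /predU1P[-> //|/bu].
      by rewrite bm ltnNge xm.
    rewrite (cycle_word_unique cw' cv xw xv) /=; apply/val_inj/eqP.
    by rewrite eqn_leq (cycle_word_head cv xv) /= bm xm.
  have [w' cw1 xw1] := mt x.
  rewrite (cycle_word_unique cw' (keep _ _ xz cw1 xw1) xw xw1).
  apply: hd => //; rewrite ltn_neqAle xm andbT; apply: contraNneq xz => exm.
  by have -> : x = y by apply: val_inj.
have [cs [sw fs ss al]] := IHk m.+1 s' lek' ms' hd'.
have sb : (s'^-1)%g b = last b v.
  by apply: canLR (permK s') _; rewrite (cycle_word_perm_last cv).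
(* The added cell is the dot of [t] linking the two factors. Its row [m] is below all earlier rows,
   which are at least [m.+1]. *)
exists (rcons cs (last a u, b)); split.
- by rewrite switchable_rcons sw fs inE /= sb (cycle_word_perm_last cu) ab.
- by rewrite foldl_rcons fs /switching /= sb -et.
- case: cs ss al {sw fs} => // c cs ss /allP al.
  rewrite /= in ss; rewrite /= rcons_path ss bm /=.
  exact: al (mem_last c cs).
- rewrite all_rcons /= bm leqnn /=.
  by apply: sub_all al => c /ltnW.
Qed.

Lemma merge_perm_web_permutation t : merge_perm t -> web_permutation t.
Proof.
move=> mt; have [//|cs [sw <- ss _]] := @merge_perm_switchings t 0 mt.
have [||r R h] := @resolution_foldl_switching n 1%g set0 cs _ sw ss.
- exact: sub0set.
- by move=> c _; split=> [|e]; rewrite inE.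
by exists r.
Qed.

Lemma porbit_fcycle s w x : fcycle s w -> x \in w -> porbit s x =i w.
Proof.
move=> fw xw y; rewrite -(fconnect_cycle fw xw); apply/porbitP/idP.
  by case=> i ->; rewrite permX fconnect_iter.
by move=> /iter_findex <-; exists (findex s x y); rewrite permX.
Qed.

(** The least letter of the cycle is the one that [andre_merge_word] puts in front and
    [merge_word_andre] removes. *)
Lemma andre_cycle_porbit s x :
  andre_cycle s (porbit s x) <-> exists2 w, cycle_word s w & x \in w.
Proof.
split=> [[a [w [[uw fw eC] aw anw]]]|[w cw xw]].
  have xw : x \in a :: w by rewrite eC porbit_id.
  exists (a :: w) => //; split=> //; apply: andre_merge_word anw _ _.
  rewrite all_map; apply/allP => y yw.
  rewrite /= ltnS ltn_neqAle (allP aw) // andbT.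
  by apply: contraTneq yw => /val_inj <-; case/andP: uw.
have [a [u ew]] := cycle_word_cons cw; subst w; have [mw uw fw] := cw.
exists a, u; split.
- by split=> // y; rewrite (porbit_fcycle fw xw).
- by apply/allP => y yu; apply: (cycle_word_head cw); rewrite inE yu orbT.
- apply: merge_word_andre mw; last by rewrite all_map; apply/allP.
  by rewrite -[_ :: _]/(letters (a :: u)) letters_uniq.
Qed.

End AndreCycles.

Theorem theorem3p4 (n : nat) (hn : 1 <= n) (s : {perm 'I_n}) :
  web_permutation s <-> (forall C : {set 'I_n}, C \in porbits s -> andre_cycle s C).
Proof.
split=> [/web_permutation_merge_perm ms C /imsetP[x _ ->]|h].
  exact/andre_cycle_porbit/ms.
apply: merge_perm_web_permutation => x.
by apply/andre_cycle_porbit/h/imset_f.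
Qed.
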